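(* Let $a,b\ge 3$ and $k\ge 2$ be integers and let $G=CB(k,a,b)$ be the cycle barbell. Then \[ \mathscr{K}_{nb}(G)=\frac{2(a+b+k-1)^2+3(a+b)^2+2ab+4(a+b)(k-1)-(a+b+k-1)}{2(a+b+k-1)}. \]
   Context: The cycle barbell $CB(k,a,b)$ is the graph obtained from a cycle $C_a$, a path $P_k$ on $k$ vertices and a cycle $C_b$ by identifying one endpoint of the path with a vertex of $C_a$ and the other endpoint with a vertex of $C_b$. It has $a+b+k-2$ vertices and $a+b+k-1$ edges. Kemeny's constant of an irreducible finite Markov chain with transition matrix $P$ whose eigenvalues (with multiplicity) are $1=\rho_1,\rho_2,\dots,\rho_N$ (with $1$ simple) is $\mathscr{K}(P)=\sum_{i=2}^{N}\frac{1}{1-\rho_i}$. $\mathscr{K}_{nb}(G)$ is Kemeny's constant of the non-backtracking random walk on the arcs of $G$ (ordered pairs $(u,v)$ with $\{u,v\}$ an edge), where from $(u,v)$ one moves to $(v,w)$ with probability $1/(\deg(v)-1)$ for each neighbor $w\neq u$ of $v$. *)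

(* Defs.v *)
From HB Require Import structures.
From mathcomp Require Import all_boot all_order all_algebra all_field.
Set Implicit Arguments. Unset Strict Implicit. Unset Printing Implicit Defensive.
Import Order.TTheory GRing.Theory Num.Theory.
Local Open Scope ring_scope.

Definition eigenvalues (N : nat) (P : 'M[algC]_N) : seq algC :=
  sval (closed_field_poly_normal (char_poly P)).

(* K(P) = sum_{i=2}^N 1/(1 - rho_i), where rho_1 = 1 is removed once from
   the list of eigenvalues (1 is assumed simple in the paper). *)
Definition kemeny (N : nat) (P : 'M[algC]_N) : algC :=
  \sum_(z <- rem 1 (eigenvalues P)) (1 - z)^-1.

Section NB.
Variables (V : finType) (adj : rel V).

Definition deg (v : V) : nat := #|[set w | adj v w]|.

Definition arc := {p : V * V | adj p.1 p.2}.

Definition nb_matrix : 'M[algC]_#|{: arc}| :=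
  \matrix_(i, j)
    let x := val (enum_val i) in let y := val (enum_val j) in
    if (x.2 == y.1) && (y.2 != x.1) then ((deg x.2)%:R - 1)^-1 else 0.

Definition kemeny_nb : algC := kemeny nb_matrix.
End NB.

(* Vertex set 'I_(a+b+k-2).  C_a is on 0,...,a-1 (cyclically);
   the path P_k is a-1, a, ..., a+k-2;
   C_b is on a+k-2, ..., a+b+k-3 (cyclically).
   The path endpoint a-1 is identified with a vertex of C_a and the
   endpoint a+k-2 with a vertex of C_b. *)
Definition cyc_adj (lo len u v : nat) : bool :=
  [&& lo <= u < lo + len, lo <= v < lo + len &
      [|| u.+1 == v, v.+1 == u,
          (u == lo) && (v == lo + len - 1) | (v == lo) && (u == lo + len - 1)]]%N.

Definition path_adj (lo len u v : nat) : bool :=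
  [&& lo <= u < lo + len, lo <= v < lo + len & (u.+1 == v) || (v.+1 == u)]%N.

Definition cb_adj (k a b : nat) : rel 'I_(a + b + k - 2) :=
  fun u v => [|| cyc_adj 0 a u v, path_adj (a - 1) k u v
                | cyc_adj (a + k - 2) b u v]%N.
Arguments cb_adj k a b : clear implicits.

(* Main.v *)
Require Import Defs.
From HB Require Import structures.
From mathcomp Require Import all_boot all_order all_algebra all_field.
From mathcomp Require Import fingroup perm zify ring.
Import Order.TTheory GRing.Theory Num.Theory.
Local Open Scope ring_scope.
Set Implicit Arguments. Unset Strict Implicit. Unset Printing Implicit Defensive.

(* If 1 is a simple root of the characteristic polynomial p of P, the
   logarithmic derivative of p / (X - 1) at 1 gives K(P) = p''(1) / (2 p'(1)).
   The arcs of the barbell split into six chains along which the walk is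
   deterministic, so p is the 6 x 6 determinant of X^(length) - (weights of the
   jumps between chains), namely
     p = (X^a - 1/2) (X^b - 1/2)
         ((X^a - 1/2) (X^b - 1/2) X^(2(k-1)) - 1/4). *)

(** * General determinant identities *)

(** Rows and columns undergo the same permutation, so its sign occurs twice and cancels. *)
Lemma det_reindex (R : comNzRingType) (T : finType) (n : nat) (e : 'I_n -> T)
    (F : T -> T -> R) : bijective e ->
  \det (\matrix_(i < #|T|, j < #|T|) F (enum_val i) (enum_val j)) =
  \det (\matrix_(i < n, j < n) F (e i) (e j)).
Proof.
move=> be; have := bij_eq_card be; rewrite card_ord => En; subst n.
have inj : injective (fun i => enum_rank (e i)).
  by move=> i j /enum_rank_inj /(bij_inj be).
pose M : 'M[R]_#|T| := \matrix_(i, j) F (enum_val i) (enum_val j).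
have -> : (\matrix_(i, j) F (e i) (e j)) =
    row_perm (perm inj) (col_perm (perm inj) M).
  by apply/matrixP=> i j; rewrite !mxE !permE !enum_rankK.
rewrite row_permE col_permE !det_mulmx !det_perm odd_permV.
by rewrite mulrC -mulrA -signr_addb addbb mulr1.
Qed.

(* A permutation other than the identity cannot weakly increase the rank
   everywhere and strictly where it moves a point. *)
Lemma det_ranked (R : comNzRingType) (n : nat) (rk : 'I_n -> nat) (M : 'M[R]_n) :
  (forall i j, i != j -> (rk j <= rk i)%N -> M i j = 0) ->
  \det M = \prod_i M i i.
Proof.
move=> M0; rewrite /determinant (bigD1 1%g) //= odd_perm1 expr0 mul1r.
rewrite [X in _ + X]big1 ?addr0; first by apply: eq_bigr => i _; rewrite perm1.
move=> s ns1.
have [/existsP[i /andP[si ri]]|/existsPn H] :=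
  boolP [exists i, (i != s i) && (rk (s i) <= rk i)%N].
  by rewrite (bigD1 i) //= M0 // mul0r mulr0.
have le i : (rk i <= rk (s i) ?= iff (i == s i))%N.
  have := H i; rewrite negb_and negbK -ltnNge; case: eqP => [<-|_] /=.
    by split; rewrite ?leqnn ?eqxx.
  by move=> ?; split; [exact: ltnW | rewrite ltn_eqF].
(* The ranks and the ranks along [s] have the same sum, so every inequality is an equality and [s]
   fixes every point. *)
have := (leqif_sum (fun i (_ : true) => le i)).2.
rewrite [X in _ == X](_ : _ = \sum_i rk i)%N; last first.
  by rewrite [RHS](reindex_inj (@perm_inj _ s)).
rewrite eqxx => /esym/forallP fix_s; case/eqP: ns1; apply/permP => i.
by rewrite perm1; apply/esym/eqP; exact: fix_s.
Qed.

(** Left multiplication by the block matrix with rows [D], [C] and [0], [1] clears the upper right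
    block. The factor [\det D] is kept so that nothing is divided. *)
Lemma det_block_elim (R : comNzRingType) (m n : nat) (D A : 'M[R]_m)
    (B C : 'M[R]_(m, n)) (E : 'M[R]_(n, m)) (F : 'M[R]_n) :
  D *m B + C *m F = 0 ->
  \det D * \det (block_mx A B E F) = \det (D *m A + C *m E) * \det F.
Proof.
move=> H; have -> : \det D = \det (block_mx D C 0 1%:M).
  by rewrite det_ublock det1 mulr1.
by rewrite -det_mulmx mulmx_block !mul0mx !mul1mx !add0r H det_lblock.
Qed.

(** * Collapsing deterministic chains in a characteristic determinant *)

Section Chains.
Variables (R : idomainType) (T : finType) (m : nat).
Variables (cls : T -> 'I_m) (pos : T -> nat) (len : 'I_m -> nat).
Variables (x : R) (P : T -> T -> R) (w : 'I_m -> 'I_m -> R).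
Hypothesis x0 : x != 0.
Hypothesis len_gt0 : forall c, (0 < len c)%N.
Hypothesis pos_lt : forall t, (pos t < len (cls t))%N.
Hypothesis chain_inj : forall t t', cls t = cls t' -> pos t = pos t' -> t = t'.
Hypothesis chain_ex : forall c i, (i < len c)%N -> exists2 t, cls t = c & pos t = i.
Hypothesis PE : forall t t', P t t' =
  if pos t' == 0%N then (if (pos t).+1 == len (cls t) then w (cls t) (cls t') else 0)
  else ((cls t' == cls t) && (pos t' == (pos t).+1))%:R.

(* Row operation: for each chain, replace the row of its first state by the
   combination of its rows with weights x ^ (len - 1 - position). This clears
   the columns of all other states, whose remaining block is triangular. *)
Lemma det_chains :
  \det (\matrix_(i < #|T|, j < #|T|)
     (x *+ (enum_val i == enum_val j) - P (enum_val i) (enum_val j))) =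
  \det (\matrix_(c, c') (x ^+ len c *+ (c == c') - w c c')).
Proof.
have [first cls_first pos_first] :
    exists2 f : 'I_m -> T, forall c, cls (f c) = c & forall c, pos (f c) = 0%N.
  have /fin_all_exists[f fP] : forall c, exists t, cls t = c /\ pos t = 0%N.
    by move=> c; have [t ? ?] := chain_ex (len_gt0 c); exists t.
  by exists f => c; case: (fP c).
(* The enumeration [e] lists the [m] chain starts first and the [r] other states after them, which
   fixes the block decomposition. *)
pose later := [pred t | pos t != 0%N]; pose r := #|later|.
pose e (k : 'I_(m + r)) : T :=
  match split k with inl c => first c | inr j => enum_val j end.
have e_l c : e (lshift r c) = first c.
  by rewrite /e (unsplitK (inl c)).
have e_r (j : 'I_r) : e (rshift m j) = enum_val j.
  by rewrite /e (unsplitK (inr j)).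
have pos_r (j : 'I_r) : pos (enum_val j) != 0%N by exact: (enum_valP j).
have be : bijective e.
  apply: inj_card_bij.
    move=> i j; rewrite -(splitK i) -(splitK j).
    case: (split i) => i'; case: (split j) => j' /=; rewrite ?e_l ?e_r.
    - by move/(congr1 cls); rewrite !cls_first => ->.
    - by move=> E; have := pos_r j'; rewrite -E pos_first.
    - by move=> E; have := pos_r i'; rewrite E pos_first.
    - by move/enum_val_inj ->.
  have sur t : t \in codom e.
    have [p0|p0] := eqVneq (pos t) 0%N.
      have <- : e (lshift r (cls t)) = t.
        by apply: chain_inj; rewrite e_l ?cls_first ?pos_first.
      exact: codom_f.
    have tl : t \in later by [].
    have <- : e (rshift m (enum_rank_in tl t)) = t.
      by rewrite e_r enum_rankK_in.
    exact: codom_f.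
  have <- : #|codom e| = #|T| by apply: eq_card => t; rewrite sur.
  exact: leq_trans (card_size _) (eq_leq (size_codom e)).
rewrite (det_reindex (fun t t' => x *+ (t == t') - P t t') be).
set M := (\matrix_(i, j) _ : 'M_(m + r)).
rewrite -[M]submxK.
pose D : 'M[R]_m := diag_mx (\row_c x ^+ (len c).-1).
pose C : 'M[R]_(m, r) := \matrix_(c, j)
  (x ^+ ((len c).-1 - pos (enum_val j)) *+ (cls (enum_val j) == c)).
(* A state that is not a chain start is entered only from its predecessor, so this block is
   triangular for [pos], with diagonal [x]. *)
have detF : \det (drsubmx M) = x ^+ r.
  rewrite (@det_ranked _ _ (fun j => pos (enum_val j))).
    rewrite -[in RHS](card_ord r) -prodr_const; apply: eq_bigr => j _.
    rewrite !mxE e_r eqxx mulr1n PE (negPf (pos_r j)) eqxx /=.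
    by rewrite [_ == _.+1]ltn_eqF // subr0.
  move=> i j ij le; rewrite !mxE !e_r PE (negPf (pos_r j)).
  rewrite (inj_eq enum_val_inj) (negPf ij) mulr0n.
  by rewrite [pos _ == _]ltn_eqF ?ltnS // andbF subr0.
have detD : \det D = x ^+ (\sum_c (len c).-1).
  rewrite det_diag -prodrXr.
  by apply: eq_bigr => c _; rewrite mxE.
have sum_rest : (\sum_c (len c).-1)%N = r.
  rewrite /r -sum1_card (partition_big cls xpredT) //=; apply: eq_bigr => c _.
  rewrite sum1dep_card cardE -(size_map pos) -(size_iota 1 (len c).-1).
  apply/perm_size; rewrite perm_sym; apply: uniq_perm.
  - rewrite map_inj_in_uniq ?enum_uniq // => t t'.
    rewrite !mem_enum !inE => /andP[_ /eqP Et] /andP[_ /eqP Et'].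
    by apply: chain_inj; rewrite Et Et'.
  - exact: iota_uniq.
  move=> i; rewrite mem_iota; apply/mapP/idP => [[t]|/andP[i0 il]].
    rewrite mem_enum !inE => /andP[pt /eqP Et] ->; have := pos_lt t.
    by rewrite Et; lia.
  have [|t Et pt] := @chain_ex c i; first by lia.
  by exists t; rewrite // mem_enum !inE Et pt eqxx andbT; lia.
have row_sum c (j : 'I_(m + r)) :
    (row_mx D C *m M) c j = \sum_(t | cls t == c)
      x ^+ ((len c).-1 - pos t) * (x *+ (t == e j) - P t (e j)).
  rewrite mxE [RHS](reindex e); last exact: onW_bij.
  rewrite [LHS](bigID (fun k => cls (e k) == c)) /= [X in _ + X]big1 ?addr0.
    apply: eq_bigr => k; rewrite -(splitK k); case: (split k) => k' /=.
      rewrite row_mxEl !mxE e_l cls_first => /eqP ->.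
      by rewrite eqxx mulr1n pos_first subn0.
    by rewrite row_mxEr !mxE e_r => ->.
  move=> k; rewrite -(splitK k); case: (split k) => k' /=.
    by rewrite row_mxEl !mxE e_l cls_first eq_sym => /negPf ->; rewrite mul0r.
  by rewrite row_mxEr !mxE e_r => /negPf ->; rewrite mul0r.
have M_blocks : row_mx D C *m M =
    row_mx (D *m ulsubmx M + C *m dlsubmx M) (D *m ursubmx M + C *m drsubmx M).
  by rewrite -[in LHS](submxK M) mul_row_block.
(* In the column of a later state [t] only the rows of [t] and of its predecessor [s] contribute;
   the extra factor [x] on the diagonal matches the exponent of [s], larger by one, and the two
   terms cancel. *)
have H0 : D *m ursubmx M + C *m drsubmx M = 0.
  rewrite -(row_mxKr (D *m ulsubmx M + C *m dlsubmx M) (_ + _)) -M_blocks.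
  apply/matrixP => c j; rewrite mxE row_sum mxE e_r; set t := enum_val j.
  have tp : pos t != 0%N := pos_r j.
  have tl := pos_lt t.
  have [ct|ct] := eqVneq (cls t) c; last first.
    apply: big1 => t' /eqP Et'; rewrite PE (negPf tp) Et' (negPf ct) subr0.
    by case: eqP => [E|_]; [rewrite -E Et' eqxx in ct | rewrite mulr0].
  have [|s cs ps] := @chain_ex c (pos t).-1; first by rewrite ct in tl; lia.
  have ts : t != s by apply/eqP => E; move: ps; rewrite -E; lia.
  rewrite (bigD1 t) ?ct //= (bigD1 s) /=; last by rewrite cs eqxx eq_sym.
  rewrite big1 ?addr0 => [|u /andP[/andP[/eqP cu ut] us]]; last first.
    rewrite (negPf ut) PE (negPf tp) [pos t == _]negbTE ?andbF ?subrr ?mulr0 //.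
    apply: contraNneq us => E; apply/eqP/chain_inj; rewrite ?cu //; lia.
  rewrite !PE (negPf tp) eqxx [s == t]eq_sym (negPf ts) ct cs eqxx ps.
  rewrite prednK ?lt0n // eqxx [pos t == _]ltn_eqF //= subr0 sub0r mulrN mulr1.
  rewrite ct in tl.
  have -> : ((len c).-1 - (pos t).-1 = ((len c).-1 - pos t).+1)%N by lia.
  by rewrite exprSr mulr1n subrr.
(* In the column of a chain start, the start itself gives [x ^+ len c], and the last state of chain
   [c], whose multiplier is [x ^+ 0], gives the jump weight. *)
have H1 : D *m ulsubmx M + C *m dlsubmx M =
    \matrix_(c, c') (x ^+ len c *+ (c == c') - w c c').
  rewrite -[LHS](row_mxKl _ (D *m ursubmx M + C *m drsubmx M)) -M_blocks.
  apply/matrixP => c c'; rewrite mxE row_sum mxE e_l.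
  have [|s cs ps] := @chain_ex c (len c).-1; first by have := len_gt0 c; lia.
  under eq_bigr do rewrite mulrBr.
  rewrite big_split /= sumrN; congr (_ - _).
    have [<-|cc'] := eqVneq c c'.
      rewrite (bigD1 (first c)) ?cls_first //= big1 => [|t /andP[_ /negPf ->]].
        by rewrite eqxx mulr1n pos_first subn0 -exprSr prednK // addr0.
      by rewrite mulr0.
    rewrite big1 // => t /eqP ct; case: eqP => [E|_]; last by rewrite mulr0.
    by rewrite -ct E cls_first eqxx in cc'.
  rewrite (bigD1 s) ?cs //= big1 => [|t /andP[/eqP ct ts]]; last first.
    rewrite PE pos_first /= ifN ?mulr0 // ct; apply: contraNneq ts => E.
    by apply/eqP/chain_inj; rewrite ?ct // ps -E.
  by rewrite PE pos_first /= cs ps prednK // eqxx cls_first subnn mul1r addr0.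
(* [D] and the lower right block both have determinant [x ^+ r], which is nonzero and cancels. *)
apply: (@mulfI _ (\det D)); first by rewrite detD expf_neq0.
by rewrite (det_block_elim _ _ H0) H1 detF detD sum_rest mulrC.
Qed.
End Chains.

(** * The explicit 6 x 6 determinant *)

(** First-row expansion on functions of natural numbers, so that for a numeral size it computes to a
    plain ring expression. *)
Fixpoint laplace_det (R : nzRingType) (n : nat) (F : nat -> nat -> R) : R :=
  if n is n'.+1 then
    foldr (fun j s => F 0%N j * ((-1) ^+ j *
       laplace_det n' (fun i j' => F i.+1 (bump j j'))) + s) 0 (iota 0 n)
  else 1.

Lemma det_laplace (R : comNzRingType) (n : nat) (F : nat -> nat -> R) :
  \det (\matrix_(i < n, j < n) F i j) = laplace_det n F.
Proof.
elim: n F => [|n IH] F; first by rewrite det_mx00.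
transitivity (\sum_(0 <= j < n.+1) F 0%N j * ((-1) ^+ j *
    laplace_det n (fun i j' => F i.+1 (bump j j')))); last by rewrite unlock.
rewrite (expand_det_row _ ord0) big_mkord.
apply: eq_bigr => j _; rewrite mxE /cofactor -IH.
by congr (_ * (_ * \det _)); apply/matrixP => i j'; rewrite !mxE.
Qed.

(** To be used with [h] = 1/2, [p] = X^a, [q] = X^b, [r] = X^(k-1). A symbolic [h] makes this a
    polynomial identity within reach of [ring]. *)
Lemma det_barbell (R : comNzRingType) (h p q r : R) :
  \det (\matrix_(i < 6, j < 6) nth 0 (nth [::]
   [:: [:: p - h; 0; - h; 0; 0; 0];
       [:: 0; p - h; - h; 0; 0; 0];
       [:: 0; 0; r; - h; - h; 0];
       [:: 0; 0; 0; q - h; 0; - h];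
       [:: 0; 0; 0; 0; q - h; - h];
       [:: - h; - h; 0; 0; 0; r]] i) j) =
  (p - h) * (q - h) * ((p - h) * (q - h) * r ^+ 2 - (2 * h * h) ^+ 2).
Proof.
rewrite (det_laplace 6 (fun i j => nth 0 (nth [::] _ i) j)).
rewrite /laplace_det /iota /foldr /bump; rewrite [LHS]/=.
rewrite !(mul0r, add0r, addr0).
by ring.
Qed.

(** * Kemeny's constant from derivatives of the characteristic polynomial *)

Lemma horner_deriv_prod_XsubC (F : fieldType) (s : seq F) (y : F) : y \notin s ->
  (\prod_(z <- s) ('X - z%:P))^`().[y] =
  (\prod_(z <- s) ('X - z%:P)).[y] * \sum_(z <- s) (y - z)^-1.
Proof.
elim: s => [|z s IH]; first by rewrite !big_nil derivC hornerC mulr0.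
rewrite inE negb_or => /andP[yz ys]; have yz0 : y - z != 0 by rewrite subr_eq0.
rewrite !big_cons derivM derivXsubC mul1r hornerD !hornerM IH // hornerXsubC.
by field.
Qed.

Lemma kemeny_deriv (N : nat) (P : 'M[algC]_N) :
  (char_poly P).[1] = 0 -> (char_poly P)^`().[1] != 0 ->
  kemeny P = (char_poly P)^`()^`().[1] / (2 * (char_poly P)^`().[1]).
Proof.
rewrite /kemeny /eigenvalues; case: closed_field_poly_normal => s /=.
rewrite (monicP (char_poly_monic P)) scale1r => -> /eqP p1.
have s1 : 1 \in s by rewrite -[_ == 0]/(root _ 1) root_prod_XsubC in p1.
rewrite (perm_big _ (perm_to_rem s1)) big_cons; set q := \prod_(z <- _) _.
have q1 : (('X - 1%:P) * q)^`().[1] = q.[1].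
  by rewrite derivM derivXsubC mul1r hornerD hornerM hornerXsubC subrr mul0r addr0.
have q2 : (('X - 1%:P) * q)^`()^`().[1] = 2 * q^`().[1].
  rewrite derivM derivXsubC mul1r derivD derivM derivXsubC mul1r !hornerD hornerM.
  by rewrite hornerXsubC subrr mul0r; ring.
rewrite q1 q2 => q0.
(* Here [q0] says that 1 is not a root of [q], that is, 1 is a simple eigenvalue. *)
rewrite horner_deriv_prod_XsubC; last first.
  by rewrite -root_prod_XsubC; exact: q0.
by rewrite -/q; field; rewrite q0.
Qed.

Lemma horner_derivM (R : comNzRingType) (p q : {poly R}) (y : R) :
  (p * q)^`().[y] = p^`().[y] * q.[y] + p.[y] * q^`().[y].
Proof. by rewrite derivM hornerD !hornerM. Qed.

Lemma horner_deriv2M (R : comNzRingType) (p q : {poly R}) (y : R) :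
  (p * q)^`()^`().[y] =
  p^`()^`().[y] * q.[y] + 2 * (p^`().[y] * q^`().[y]) + p.[y] * q^`()^`().[y].
Proof. by rewrite !derivM derivD !hornerD !horner_derivM; ring. Qed.

(** The polynomial is [F * G] with [G] vanishing at 1, so its first two derivatives there are F G'
    and 2 F' G' + F G''. *)
Lemma kemeny_barbell_char_poly (a b k N : nat) (P : 'M[algC]_N) :
  (3 <= a)%N -> (3 <= b)%N -> (2 <= k)%N ->
  char_poly P = ('X^a - (2^-1)%:P) * ('X^b - (2^-1)%:P) *
   (('X^a - (2^-1)%:P) * ('X^b - (2^-1)%:P) * 'X^(k - 1) ^+ 2
    - (2 * (2^-1)%:P * (2^-1)%:P) ^+ 2) ->
  kemeny P =
  (2 * (a + b + k - 1)%:R ^+ 2 + 3 * (a + b)%:R ^+ 2 + 2 * (a * b)%:R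
     + 4 * (a + b)%:R * (k%:R - 1) - (a + b + k - 1)%:R)
  / (2 * (a + b + k - 1)%:R).
Proof.
(* From here [a], [b], [k] stand for the original values minus 1, 1 and 2; thus the exponent 2(k-1)
   becomes [k.*2.+2]. *)
case: a => // a _; case: b => // b _; case: k => [//|[//|k]] _.
set h : algC := 2^-1; move=> pE.
have hE : 2 * h = 1 by rewrite mulfV ?pnatr_eq0.
have X0 n : ('X^n - h%:P).[1] = h.
  by rewrite hornerD hornerN hornerC hornerXn expr1n -hE; ring.
have X1 n : ('X^(n.+1) - h%:P)^`().[1] = n.+1%:R.
  by rewrite derivB derivC subr0 derivXn hornerMn hornerXn expr1n.
have X2 n : ('X^(n.+1) - h%:P)^`()^`().[1] = n.+1%:R * n%:R.
  by rewrite derivB derivC subr0 derivXn derivMn derivXn !hornerMn hornerXn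
    expr1n -natrM -mulrnA mulnC.
have Y0 n : ('X^n : {poly algC}).[1] = 1 by rewrite hornerXn expr1n.
have Y1 n : ('X^(n.+1) : {poly algC})^`().[1] = n.+1%:R.
  by rewrite derivXn hornerMn hornerXn expr1n.
have Y2 n : ('X^(n.+1) : {poly algC})^`()^`().[1] = n.+1%:R * n%:R.
  by rewrite derivXn derivMn derivXn !hornerMn hornerXn expr1n -natrM -mulrnA mulnC.
have cE : (2 * h%:P * h%:P) ^+ 2 = (h ^+ 2)%:P :> {poly algC}.
  have -> : 2 * h%:P = 1 :> {poly algC} by rewrite -polyCMn -polyCM hE.
  by rewrite mul1r rmorphXn.
rewrite subSS subn0 cE -exprM muln2 doubleS in pE.
set F := ('X^(a.+1) - h%:P) * ('X^(b.+1) - h%:P) in pE.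
set G := F * _ - _ in pE.
have F0 : F.[1] = h ^+ 2 by rewrite hornerM !X0 expr2.
have F1 : F^`().[1] = h * (a.+1%:R + b.+1%:R).
  by rewrite horner_derivM !X0 !X1; ring.
have F2 : F^`()^`().[1] = h * (a.+1%:R * a%:R + b.+1%:R * b%:R) + 2 * (a.+1%:R * b.+1%:R).
  by rewrite horner_deriv2M !X0 !X1 !X2; ring.
have G0 : G.[1] = 0 by rewrite hornerD hornerN hornerC hornerM F0 Y0 mulr1 subrr.
have G1 : G^`().[1] = h * (a.+1%:R + b.+1%:R) + h ^+ 2 * k.*2.+2%:R.
  by rewrite derivB derivC subr0 horner_derivM F0 F1 Y0 Y1; ring.
have G2 : G^`()^`().[1] = F^`()^`().[1] + 2 * (h * (a.+1%:R + b.+1%:R) * k.*2.+2%:R)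
    + h ^+ 2 * (k.*2.+2%:R * k.*2.+1%:R).
  by rewrite derivB derivC subr0 horner_deriv2M F0 F1 Y0 Y1 Y2; ring.
have sumE : (a.+1 + b.+1 + k.+2 - 1 = a + b + k + 3)%N by lia.
have m0 : a%:R + b%:R + k%:R + 3 != 0 :> algC by rewrite -!natrD pnatr_eq0; lia.
(* The sum is the number of edges of the barbell in the shifted variables, the source of the
   denominator. *)
have G1' : G^`().[1] = h * (a%:R + b%:R + k%:R + 3).
  by rewrite G1 -muln2 -!natr1 natrM /h; field.
have h0 : h != 0 by rewrite invr_eq0 pnatr_eq0.
have p1 : (char_poly P)^`().[1] = h ^+ 2 * G^`().[1].
  by rewrite pE horner_derivM G0 F0 mulr0 add0r.
have p2 : (char_poly P)^`()^`().[1] = 2 * (F^`().[1] * G^`().[1]) + h ^+ 2 * G^`()^`().[1].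
  by rewrite pE horner_deriv2M G0 F0 mulr0 add0r.
rewrite kemeny_deriv.
- rewrite p2 p1 G2 F2 F1 G1' sumE !natrD natrM -muln2 -!natr1 natrM /h.
  by field.
- by rewrite pE hornerM G0 mulr0.
- by rewrite p1 G1' !mulf_neq0 // expf_neq0.
Qed.

(** * Arcs of the barbell, their chains and the vertex degrees *)

Section Barbell.
Variables (a b k : nat).
Hypotheses (ha : (3 <= a)%N) (hb : (3 <= b)%N) (hk : (2 <= k)%N).
Local Open Scope nat_scope.

Definition cb_adjn u v := [|| cyc_adj 0 a u v, path_adj (a - 1) k u v
                | cyc_adj (a + k - 2) b u v].

(* The arcs form six chains on which the walk is deterministic, each starting
   and ending at a vertex of degree 3: 0 and 1 are the two orientations of C_a,
   3 and 4 those of C_b, and 2 and 5 run along the path from C_a to C_b and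
   back. *)
Definition chain_len c :=
  match c with 0 | 1 => a | 3 | 4 => b | _ => k - 1 end.

(** Arc [i] of chain [c] goes from vertex [i] to vertex [i.+1] of the chain; the case distinctions
    close up the cycles. *)
Definition chain_vertex c i :=
  match c with
  | 0 => if i == 0 then a - 1 else i - 1
  | 1 => if i < a then a - 1 - i else a - 1
  | 2 => a - 1 + i
  | 3 => if i < b then a + k - 2 + i else a + k - 2
  | 4 => if i == 0 then a + k - 2 else a + k - 2 + b - i
  | _ => a + k - 2 - i
  end.

(** With [chain_pos], the inverse of [chain_vertex] on arcs. The extra disjuncts catch the closing
    arc of a cycle: the first arc of chain 0, the last of chain 3. *)
Definition chain_class u v :=
  if (u < a) && (v < a) then
    if (v == u.+1) || (u == a - 1) && (v == 0) then 0 else 1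
  else if (a + k - 2 <= u) && (a + k - 2 <= v) then
    if (v == u.+1) || (u == a + k - 2 + b - 1) && (v == a + k - 2) then 3 else 4
  else if v == u.+1 then 2 else 5.

Definition chain_pos u v :=
  match chain_class u v with
  | 0 => v
  | 1 => a - 1 - u
  | 2 => u - (a - 1)
  | 3 => u - (a + k - 2)
  | 4 => if u == a + k - 2 then 0 else a + k - 2 + b - u
  | _ => a + k - 2 - u
  end.

(** Of the three chains starting where [c] ends, the missing one begins by reversing the last arc of
    [c]. *)
Definition chain_link c c' :=
  match c, c' with
  | 0, 0 | 0, 2 | 1, 1 | 1, 2 | 2, 3 | 2, 4 | 3, 3 | 3, 5 | 4, 4 | 4, 5
  | 5, 0 | 5, 1 => true
  | _, _ => false
  end.

Lemma chain_vertex_class u v : cb_adjn u v ->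
  [/\ chain_class u v < 6, chain_pos u v < chain_len (chain_class u v),
      chain_vertex (chain_class u v) (chain_pos u v) = u &
      chain_vertex (chain_class u v) (chain_pos u v).+1 = v].
Proof.
rewrite /chain_pos /cb_adjn /cyc_adj /path_adj => uv.
have [[[[[E|E]|E]|E]|E]|E] : (((((chain_class u v = 0 \/ chain_class u v = 1)
  \/ chain_class u v = 2) \/ chain_class u v = 3) \/ chain_class u v = 4)
  \/ chain_class u v = 5).
  by rewrite /chain_class; do ![case: ifP => _]; tauto.
all: rewrite E /=; move: E; rewrite /chain_class;
  do ![case: ifP => ?] => // _; split; rewrite ?eqxx; lia.
Qed.

Lemma chain_vertex_lt c i : c < 6 -> i <= chain_len c ->
  chain_vertex c i < a + b + k - 2.
Proof.
by move: c => [|[|[|[|[|[|c]]]]]] //= _; do ?case: ifP; lia.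
Qed.

Lemma chain_vertex_adj c i : c < 6 -> i < chain_len c ->
  cb_adjn (chain_vertex c i) (chain_vertex c i.+1).
Proof.
rewrite /cb_adjn /cyc_adj /path_adj.
move: c => [|[|[|[|[|[|c]]]]]] //= _ il; apply/or3P;
  [constructor 1|constructor 1|constructor 2|constructor 3|constructor 3|constructor 2];
  apply/and3P; split; do ?case: ifP => ?; lia.
Qed.

Lemma chain_class_vertex c i : c < 6 -> i < chain_len c ->
  chain_class (chain_vertex c i) (chain_vertex c i.+1) = c.
Proof.
move=> c6 il; rewrite /chain_class.
move: c c6 il => [|[|[|[|[|[|c]]]]]] //= _ il.
- by case: (ifP (i == 0)) => ?; rewrite ifT ?ifT //; lia.
- by rewrite il; case: (ifP (i.+1 < a)) => ?;
    (rewrite ifT; last by lia); (rewrite ifN; last by lia).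
- by do 2![rewrite ifN; last by lia]; rewrite ifT //; lia.
- by rewrite il; case: (ifP (i.+1 < b)) => ?;
    (rewrite ifN; last by lia); do 2![rewrite ifT; last by lia].
- by case: (ifP (i == 0)) => ?; (rewrite ifN; last by lia);
    (rewrite ifT; last by lia); (rewrite ifN; last by lia).
- by do 3![rewrite ifN; last by lia].
Qed.

Lemma chain_pos_vertex c i : c < 6 -> i < chain_len c ->
  chain_pos (chain_vertex c i) (chain_vertex c i.+1) = i.
Proof.
move=> c6 il; rewrite /chain_pos chain_class_vertex //.
by move: c c6 il => [|[|[|[|[|[|c]]]]]] //= _ il;
  do ?case: (ifP (i == 0)) => ?; do ?case: ifP => ?; lia.
Qed.

(** Inner vertices of a chain have a single continuation without backtracking, and branching occurs
    only at chain ends. The form is that of hypothesis [PE] of [det_chains]. *)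
Lemma chain_step c i c' i' : c < 6 -> c' < 6 -> i < chain_len c -> i' < chain_len c' ->
  (chain_vertex c i.+1 == chain_vertex c' i')
    && (chain_vertex c' i'.+1 != chain_vertex c i) =
  (if i' == 0 then (i.+1 == chain_len c) && chain_link c c'
   else (c' == c) && (i' == i.+1)).
Proof.
move: c => [|[|[|[|[|[|c]]]]]] //; move: c' => [|[|[|[|[|[|c']]]]]] // _ _ il il'.
all: rewrite /chain_link ?andbF ?andbT /= -/chain_len.
all: rewrite /= in il il'.
all: case: (ifP (i' == 0)) => ?; do ?case: ifP => ?; lia.
Qed.

Lemma card_ord_seq n (p : pred nat) (s : seq nat) : uniq s ->
  (forall w, (w < n) && p w = (w \in s)) -> #|[set w : 'I_n | p w]| = size s.
Proof.
move=> us H; rewrite cardE -(size_map val); apply: perm_size; apply: uniq_perm => //.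
  by rewrite map_inj_uniq ?enum_uniq //; exact: val_inj.
move=> w; rewrite -H; apply/mapP/andP => [[z]|[wn pw]].
  by rewrite mem_enum inE => pz ->; rewrite ltn_ord.
by exists (Ordinal wn); rewrite // mem_enum inE.
Qed.

Lemma card_neighbours v : v < a + b + k - 2 ->
  #|[set w : 'I_(a + b + k - 2) | cb_adjn v w]| =
  if (v == a - 1) || (v == a + k - 2) then 3 else 2.
Proof.
move=> vn.
have [va|va] := eqVneq v (a - 1).
  rewrite (@card_ord_seq _ (cb_adjn v) [:: 0; a - 2; a]) //;
    first by rewrite /= !inE; lia.
  move=> w; rewrite !inE; apply/idP/idP.
    by move=> /andP[wn /or3P[] /and3P[uP wP uw]]; lia.
  by case/or3P => /eqP ->; (apply/andP; split; [lia|]); apply/or3P;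
    [constructor 1|constructor 1|constructor 2]; apply/and3P; split; lia.
have [vl|vl] := eqVneq v (a + k - 2).
  rewrite (@card_ord_seq _ (cb_adjn v) [:: a + k - 3; a + k - 1; a + b + k - 3]) //;
    first by rewrite /= !inE; lia.
  move=> w; rewrite !inE; apply/idP/idP.
    by move=> /andP[wn /or3P[] /and3P[uP wP uw]]; lia.
  by case/or3P => /eqP ->; (apply/andP; split; [lia|]); apply/or3P;
    [constructor 2|constructor 3|constructor 3]; apply/and3P; split; lia.
(* The two neighbours of a degree 2 vertex precede and follow it in the numbering, except that
   vertex 0 and the last vertex wrap around to the junction on their cycle. *)
pose p := if v == 0 then a - 1 else v - 1.
pose q := if v == a + b + k - 3 then a + k - 2 else v.+1.
have pE : v = 0 /\ p = a - 1 \/ 0 < v /\ p = v - 1 by rewrite /p; case: ifP; lia.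
have qE : v = a + b + k - 3 /\ q = a + k - 2 \/ v < a + b + k - 3 /\ q = v.+1.
  by rewrite /q; case: ifP; lia.
rewrite (@card_ord_seq _ (cb_adjn v) [:: p; q]) //;
    first by rewrite /= !inE; lia.
move: p q pE qE => p q pE qE w; rewrite !inE; apply/idP/idP.
  by move=> /andP[wn /or3P[] /and3P[uP wP uw]]; lia.
move=> sw; apply/andP; split; first by lia.
have [v1|[v2|v3]] : v < a - 1 \/ (a - 1 < v /\ v < a + k - 2) \/ a + k - 2 < v by lia.
- by apply/or3P; constructor 1; apply/and3P; split; lia.
- by apply/or3P; constructor 2; apply/and3P; split; lia.
- by apply/or3P; constructor 3; apply/and3P; split; lia.
Qed.

Lemma deg_chain c i (v : 'I_(a + b + k - 2)) : c < 6 -> i < chain_len c ->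
  v = chain_vertex c i.+1 :> nat ->
  deg (cb_adj k a b) v = if i.+1 == chain_len c then 3 else 2.
Proof.
move=> c6 il Ev; rewrite [LHS](card_neighbours (ltn_ord v)) Ev.
congr (if _ then _ else _).
by move: c c6 il {Ev} => [|[|[|[|[|[|c]]]]]] //= _ il; do ?case: ifP => ?; lia.
Qed.
End Barbell.

(** * The characteristic polynomial of the walk and the final formula *)

Lemma char_poly_nb_barbell (a b k : nat) :
  (3 <= a)%N -> (3 <= b)%N -> (2 <= k)%N ->
  char_poly (nb_matrix (cb_adj k a b)) =
  ('X^a - (2^-1)%:P) * ('X^b - (2^-1)%:P) *
   (('X^a - (2^-1)%:P) * ('X^b - (2^-1)%:P) * 'X^(k - 1) ^+ 2
    - (2 * (2^-1)%:P * (2^-1)%:P) ^+ 2).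
Proof.
move=> ha hb hk; rewrite -det_barbell.
pose T := Defs.arc (cb_adj k a b).
pose cn (t : T) := chain_class a b k (val t).1 (val t).2.
pose pos (t : T) := chain_pos a b k (val t).1 (val t).2.
have tP (t : T) : [/\ (cn t < 6)%N, (pos t < chain_len a b k (cn t))%N,
    chain_vertex a b k (cn t) (pos t) = (val t).1 &
    chain_vertex a b k (cn t) (pos t).+1 = (val t).2].
  exact (chain_vertex_class ha hb hk (valP t)).
pose cls (t : T) : 'I_6 := inord (cn t).
have clsE t : cls t = cn t :> nat by rewrite inordK //; case: (tP t).
(* Jumps leave from a vertex of degree 3, hence the probability 1/(3-1). *)
pose w (c c' : 'I_6) : {poly algC} := if chain_link c c' then (2^-1)%:P else 0.
transitivity (\det (\matrix_(i < #|{: T}|, j < #|{: T}|)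
    ('X *+ (enum_val i == enum_val j) -
     (nb_matrix (cb_adj k a b) (enum_rank (enum_val i)) (enum_rank (enum_val j)))%:P))).
  congr (\det _); apply/matrixP => i j; rewrite [RHS]mxE !enum_valK.
  rewrite (inj_eq enum_val_inj) [LHS]mxE [X in X + _]mxE [X in _ + X]mxE.
  by rewrite [X in _ - X]mxE.
rewrite (@det_chains _ _ _ cls pos (fun c => chain_len a b k c) 'X
  (fun t t' : T => (nb_matrix (cb_adj k a b) (enum_rank t) (enum_rank t'))%:P) w).
- congr (\det _); apply/matrixP => -[i hi] [j hj]; rewrite !mxE /w -val_eqE /=.
  by move: i j hi hj => [|[|[|[|[|[|i]]]]]] [|[|[|[|[|[|j]]]]]] //= _ _;
    rewrite ?mulr0n ?mulr1n ?sub0r ?subr0 ?oppr0.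
- by rewrite polyX_eq0.
- by move=> [c hc]; move: c hc => [|[|[|[|[|[|c]]]]]] //= _; lia.
- by move=> t; rewrite clsE; case: (tP t).
- move=> t t' Ec Ep.
  have En : cn t = cn t' by rewrite -!clsE Ec.
  have [_ _ u v] := tP t; have [_ _ u' v'] := tP t'.
  rewrite En Ep in u v; apply: val_inj.
  rewrite [val t]surjective_pairing [val t']surjective_pairing.
  by congr (_, _); apply: ord_inj; rewrite -?u -?v.
- move=> c i il; have c6 := ltn_ord c.
  have u_lt := chain_vertex_lt ha hb hk c6 (ltnW il).
  have v_lt := chain_vertex_lt ha hb hk c6 il.
  have uv : cb_adj k a b (Ordinal u_lt) (Ordinal v_lt).
    exact (chain_vertex_adj ha hb hk c6 il).
  exists (Sub (Ordinal u_lt, Ordinal v_lt) uv : T).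
    by apply: ord_inj; rewrite clsE /cn SubK /= chain_class_vertex.
  by rewrite /pos SubK /= chain_pos_vertex.
move=> t t'; rewrite mxE !enum_rankK; cbv zeta.
have [c6 il u v] := tP t; have [c6' il' u' v'] := tP t'.
rewrite -[(val t).2 == _](inj_eq (@ord_inj _)) -[_ == (val t).1](inj_eq (@ord_inj _)).
rewrite -u -v -u' -v'.
rewrite chain_step // (@deg_chain a b k ha hb hk (cn t) (pos t)) //.
rewrite -val_eqE /= !clsE /w !clsE.
have [p0|p0] := eqVneq (pos t') 0%N.
  case: eqP => //= _; case: chain_link => //.
  by congr (_^-1)%:P; ring.
case: andP => [[/eqP cE /eqP pE]|_] //.
(* Since [t'] follows [t] on the same chain, [t] is not its last arc; its head has degree 2 and the
   step has probability 1. *)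
rewrite ifF ?polyC1; last by apply/negP; rewrite cE pE in il'; lia.
by rewrite (_ : 2%:R - 1 = 1) ?invr1 //; ring.
Qed.

Theorem theorem5p5 (a b k : nat) (ha : (3 <= a)%N) (hb : (3 <= b)%N) (hk : (2 <= k)%N) :
  kemeny_nb (cb_adj k a b) =
  (2 * (a + b + k - 1)%:R ^+ 2 + 3 * (a + b)%:R ^+ 2 + 2 * (a * b)%:R
     + 4 * (a + b)%:R * (k%:R - 1) - (a + b + k - 1)%:R)
  / (2 * (a + b + k - 1)%:R).
Proof. exact: kemeny_barbell_char_poly ha hb hk (char_poly_nb_barbell ha hb hk). Qed.
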